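(* Let $\lambda\in(-\pi/2,\pi/2)$ and let $p(z)=1+\sum_{n=1}^\infty p_nz^n\in\mathcal{P}_\lambda$. Then $$|p_n|\le 2\cos\lambda\qquad(n\ge1)$$ and $$|p'(z)|\le\frac{2\cos\lambda}{(1-r)^2},\qquad r=|z|<1.$$ The inequalities are sharp, with extremal functions of the form $z\mapsto p_\lambda(xz)$, $|x|=1$ (that is, for each $n\ge1$, respectively for each $z\in\mathbb{D}$, equality is attained by a function of this form).
   Context: $\mathbb{D}$ is the open unit disc, $\mathcal{A}_0$ is the set of analytic functions $f$ on $\mathbb{D}$ with $f(0)=1$. $\mathcal{P}_\lambda=\{p\in\mathcal{A}_0:\ \operatorname{Re}(e^{i\lambda}p(z))>0 \text{ for all } z\in\mathbb{D}\}$, and $p_\lambda(z)=\dfrac{1+e^{-2i\lambda}z}{1-z}$. *)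

(* Defs.v *)
From Stdlib Require Import Reals.
From Coquelicot Require Import Coquelicot.
Open Scope R_scope.

(** The unimodular number [e^{i t}]. *)
Definition cis (t : R) : C := (cos t, sin t).

Definition in_disc (z : C) : Prop := Cmod z < 1.

(** Functions on the disc are represented by total functions [C -> C] whose
    values outside the disc are never used; since the disc is open, [ex_derive]
    (over [C_AbsRing], i.e. complex differentiability) at a point of the disc
    depends only on the values inside it. *)
Definition analytic_on_disc (f : C -> C) : Prop :=
  forall z : C, in_disc z -> ex_derive (K := C_AbsRing) (V := C_NormedModule) f z.

Definition class_A0 (f : C -> C) : Prop :=
  analytic_on_disc f /\ f (RtoC 0) = RtoC 1.

Definition class_P (lam : R) (p : C -> C) : Prop :=
  class_A0 p /\
  forall z : C, in_disc z -> 0 < Re (Cmult (cis lam) (p z)).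

(** [p(z) = 1 + sum_{n >= 1} a_n z^n] on the disc. *)
Definition disc_expansion (p : C -> C) (a : nat -> C) : Prop :=
  a 0%nat = RtoC 1 /\
  forall z : C, in_disc z ->
    is_pseries (K := C_AbsRing) (V := C_NormedModule) a z (p z).

Definition p_lam (lam : R) (z : C) : C :=
  ((RtoC 1 + cis (- 2 * lam) * z) / (RtoC 1 - z))%C.

(* Main.v *)
Require Import Defs.
From Stdlib Require Import Reals Lra Lia.
From Coquelicot Require Import Coquelicot.
Open Scope R_scope.

(** Coefficient bound.  For a polynomial [T(z) = sum_k t_k z^k] with
    [m <= Re T] on the unit circle one has [|t_n| <= 2 (Re t_0 - m)]
    ([Cpoly_coef_bound]).  Indeed the [n]-th Fourier coefficient of
    [2 (Re T - m) = T + conj T - 2 m] is [t_n] for [n >= 1], while its mean is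
    [2 (Re t_0 - m)], and a Fourier coefficient of a nonnegative function is at
    most its mean in modulus.  The Fourier coefficients of a trigonometric
    polynomial are exact averages over the [N]-th roots of unity once [N]
    exceeds all the frequencies that occur, so the argument uses finite sums
    only.  For [p] in [P_lam] and [r < 1] it is applied to the partial sums of
    [e^{i lam} p(r z)]: they converge uniformly on the closed disc of radius
    [r] ([pseries_uniform_on_disc]), so their real part exceeds [-eps] on the
    circle, while the constant term is [e^{i lam}].  This gives
    [r^n |a_n| <= 2 cos lam + eps]; then [eps -> 0] and [r -> 1].

    Derivative bound.  If [|a_n| <= B] for [n >= 1], comparing power series
    term by term gives
    [|p w - p z| <= B |w - z| sum_n n rho^(n-1) = B |w - z| / (1 - rho)^2]
    for [|z|, |w| <= rho < 1] ([bounded_coef_lipschitz]).  As [p] is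
    differentiable by hypothesis, this Lipschitz bound passes to the derivative
    without differentiating the series, and [rho] decreases to [|z|].

    Sharpness.  The function [p_lam (x z)] has the coefficients
    [(1 + e^{-2 i lam}) x^n], [n >= 1], and the derivative
    [(1 + e^{-2 i lam}) x / (1 - x z)^2], where
    [|1 + e^{-2 i lam}| = 2 cos lam].  Every [x] on the circle is extremal for
    the coefficients, and the [x] with [x z = |z|] is extremal for the
    derivative at [z].  It belongs to [P_lam] because [e^{i lam} p_lam] is the
    Cayley map onto the right half-plane, scaled by [cos lam > 0] and
    translated by [i sin lam] ([cis_mult_p_lam]). *)

(** * Finite sums of complex numbers *)

(** [sum_n] with its type fixed to [C], so that sums are expressed through the
    complex operations that [ring] and [field] recognize. *)
Definition Csum (f : nat -> C) (N : nat) : C := sum_n f N.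

Lemma Csum_O f : Csum f 0 = f 0%nat.
Proof. apply sum_O. Qed.

Lemma Csum_S f N : Csum f (S N) = (Csum f N + f (S N))%C.
Proof. exact (sum_Sn (G := C_AbelianMonoid) f N). Qed.

Lemma Csum_ext f g N : (forall k, (k <= N)%nat -> f k = g k) -> Csum f N = Csum g N.
Proof. apply sum_n_ext_loc. Qed.

Lemma Csum_plus f g N : Csum (fun k => f k + g k)%C N = (Csum f N + Csum g N)%C.
Proof. exact (sum_n_plus (G := C_AbelianMonoid) f g N). Qed.

Lemma Csum_mult_l c f N : Csum (fun k => c * f k)%C N = (c * Csum f N)%C.
Proof. apply (sum_n_mult_l (K := C_Ring)). Qed.

Lemma Csum_mult_r c f N : Csum (fun k => f k * c)%C N = (Csum f N * c)%C.
Proof. apply (sum_n_mult_r (K := C_Ring)). Qed.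

Lemma Csum_switch (f : nat -> nat -> C) M N :
  Csum (fun i => Csum (f i) N) M = Csum (fun j => Csum (fun i => f i j) M) N.
Proof. apply sum_n_switch. Qed.

Lemma Csum_conj f N : Cconj (Csum f N) = Csum (fun k => Cconj (f k)) N.
Proof.
induction N as [|N IH]; [now rewrite !Csum_O|].
now rewrite !Csum_S, Cplus_conj, IH.
Qed.

Lemma Csum_const c N : Csum (fun _ => c) N = (RtoC (INR (S N)) * c)%C.
Proof.
induction N as [|N IH]; [rewrite Csum_O; simpl; ring|].
rewrite Csum_S, IH, (S_INR (S N)), RtoC_plus; ring.
Qed.

Lemma Csum_single f n N : (n <= N)%nat ->
  (forall k, (k <= N)%nat -> k <> n -> f k = RtoC 0) -> Csum f N = f n.
Proof.
intros Hn H.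
induction N as [|N IH].
- rewrite Csum_O; f_equal; lia.
- rewrite Csum_S. destruct (Nat.eq_dec n (S N)) as [->|Hne].
  + rewrite (Csum_ext f (fun _ => RtoC 0)), Csum_const.
    * ring.
    * intros k Hk; apply H; lia.
  + rewrite IH, (H (S N)); try lia; [ring|].
    intros k Hk; apply H; lia.
Qed.

Lemma Cmod_Csum_le f g N : (forall k, (k <= N)%nat -> Cmod (f k) <= g k) ->
  Cmod (Csum f N) <= sum_f_R0 g N.
Proof.
intros H; induction N as [|N IH].
- rewrite Csum_O; simpl; auto.
- rewrite Csum_S; simpl. eapply Rle_trans; [apply Cmod_triangle|].
  apply Rplus_le_compat; auto.
Qed.

Lemma Re_Csum f N : Re (Csum f N) = sum_f_R0 (fun k => Re (f k)) N.
Proof.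
induction N as [|N IH]; [now rewrite Csum_O|].
rewrite Csum_S; simpl; rewrite <- IH; reflexivity.
Qed.

Lemma Csum_geometric z N : ((1 - z) * Csum (fun k => z ^ k) N = 1 - z ^ S N)%C.
Proof.
induction N as [|N IH].
- rewrite Csum_O; simpl; ring.
- rewrite Csum_S, Cmult_plus_distr_l, IH, !Cpow_S; ring.
Qed.

(** * Averages over the roots of unity *)

Lemma cis_plus s t : cis (s + t) = (cis s * cis t)%C.
Proof. unfold cis, Cmult; simpl; rewrite cos_plus, sin_plus; f_equal; ring. Qed.

Lemma cis_0 : cis 0 = RtoC 1.
Proof. unfold cis; rewrite cos_0, sin_0; reflexivity. Qed.

Lemma cis_pow t n : (cis t ^ n)%C = cis (INR n * t).
Proof.
induction n as [|n IH].
- simpl; rewrite Rmult_0_l, cis_0; reflexivity.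
- rewrite Cpow_S, IH, <- cis_plus, S_INR; f_equal; ring.
Qed.

Lemma Cmod_cis t : Cmod (cis t) = 1.
Proof.
unfold Cmod, cis; simpl; rewrite !Rmult_1_r.
replace (cos t * cos t + sin t * sin t) with 1; [apply sqrt_1|].
generalize (sin2_cos2 t); unfold Rsqr; lra.
Qed.

Lemma cis_2PI : cis (2 * PI) = RtoC 1.
Proof. unfold cis; rewrite cos_2PI, sin_2PI; reflexivity. Qed.

Lemma cis_neq_1 t : 0 < t < 2 * PI -> cis t <> RtoC 1.
Proof.
intros Ht H; injection H as Hc _.
replace t with (2 * (t / 2)) in Hc by field.
rewrite cos_2a_sin in Hc.
assert (0 < sin (t / 2)) by (apply sin_gt_0; lra).
nra.
Qed.

Definition unity_root (N : nat) : C := cis (2 * PI / INR N).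

Lemma unity_root_pow N : (0 < N)%nat -> (unity_root N ^ N)%C = RtoC 1.
Proof.
intros HN; unfold unity_root; rewrite cis_pow, <- cis_2PI; f_equal.
field; apply not_0_INR; lia.
Qed.

Lemma unity_root_primitive N j : (0 < j < N)%nat ->
  (unity_root N ^ j)%C <> RtoC 1.
Proof.
intros Hj; unfold unity_root; rewrite cis_pow; apply cis_neq_1.
assert (H0 : 0 < INR j) by (apply lt_0_INR; lia).
assert (H1 : INR j < INR N) by (apply lt_INR; lia).
generalize PI_RGT_0; intros HPI.
assert (Hq : 0 < INR j / INR N < 1).
{ split; [apply Rdiv_lt_0_compat; lra|].
  apply Rmult_lt_reg_r with (INR N); [lra|].
  unfold Rdiv; rewrite Rmult_assoc, Rinv_l; lra. }
replace (INR j * (2 * PI / INR N)) with (INR j / INR N * (2 * PI)) by (field; lra).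
nra.
Qed.

Lemma Csum_unity_root_powers K j :
  (unity_root (S K) ^ j)%C <> RtoC 1 ->
  Csum (fun k => (unity_root (S K) ^ j) ^ k)%C K = RtoC 0.
Proof.
intros H; set (w := (unity_root (S K) ^ j)%C) in *.
assert (Hw : (w ^ S K)%C = RtoC 1).
{ unfold w. rewrite <- Cpow_mult_r, Nat.mul_comm, Cpow_mult_r, unity_root_pow; [|lia].
  apply Cpow_1_l. }
generalize (Csum_geometric w K); rewrite Hw; intros HG.
assert (Hne : (1 - w)%C <> RtoC 0).
{ intros E; apply H. replace w with (1 - (1 - w))%C by ring. rewrite E; ring. }
replace (Csum (fun k => w ^ k)%C K) with (((1 - w) * Csum (fun k => w ^ k)%C K) / (1 - w))%C
  by (field; auto).
rewrite HG; field; auto.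
Qed.

Definition Cpoly (t : nat -> C) (M : nat) (z : C) : C :=
  Csum (fun k => t k * z ^ k)%C M.

(** Exchanging the two sums reduces every average of a polynomial over the
    powers of [w] to geometric sums. *)
Lemma Csum_Cpoly_nodes t M K w d :
  Csum (fun k => Cpoly t M (w ^ k) * (w ^ k) ^ d)%C K
  = Csum (fun m => t m * Csum (fun k => (w ^ (m + d)) ^ k) K)%C M.
Proof.
rewrite (Csum_ext _ (fun k => Csum (fun m => t m * (w ^ (m + d)) ^ k)%C M)).
2:{ intros k _; unfold Cpoly; rewrite <- Csum_mult_r; apply Csum_ext; intros m _.
    rewrite <- Cmult_assoc, <- Cpow_add_r, <- !Cpow_mult_r.
    f_equal; f_equal; ring. }
rewrite Csum_switch; apply Csum_ext; intros m _; apply Csum_mult_l.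
Qed.

(** Averaging against [u^d] over the [S K]-th roots of unity keeps the only
    frequency [n] whose shift by [d] is a multiple of [S K]. *)
Lemma unity_root_average t M K d n : (n <= M)%nat ->
  (unity_root (S K) ^ (n + d))%C = RtoC 1 ->
  (forall m, (m <= M)%nat -> m <> n -> (unity_root (S K) ^ (m + d))%C <> RtoC 1) ->
  Csum (fun k => Cpoly t M (unity_root (S K) ^ k) * (unity_root (S K) ^ k) ^ d)%C K
  = (RtoC (INR (S K)) * t n)%C.
Proof.
intros Hn H1 H0; rewrite Csum_Cpoly_nodes, (Csum_single _ n); [|exact Hn|].
- rewrite H1, (Csum_ext _ (fun _ => RtoC 1)), Csum_const; [ring|].
  intros k _; apply Cpow_1_l.
- intros m Hm Hne; rewrite Csum_unity_root_powers; [ring|now apply H0].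
Qed.

Lemma unity_root_average_0 t M K d :
  (forall m, (m <= M)%nat -> (unity_root (S K) ^ (m + d))%C <> RtoC 1) ->
  Csum (fun k => Cpoly t M (unity_root (S K) ^ k) * (unity_root (S K) ^ k) ^ d)%C K
  = RtoC 0.
Proof.
intros H0; rewrite Csum_Cpoly_nodes, (Csum_ext _ (fun _ => RtoC 0)), Csum_const; [ring|].
intros m Hm; rewrite Csum_unity_root_powers; [ring|now apply H0].
Qed.

(** * The coefficient bound for polynomials *)

(** The Borel-Caratheodory inequality for the coefficients: the modulus of a
    Fourier coefficient of the nonnegative function [2 (Re T - m)] is at most
    its mean. *)
Lemma Cpoly_coef_bound t M n m : (1 <= n <= M)%nat ->
  (forall u, Cmod u = 1 -> m <= Re (Cpoly t M u)) ->
  Cmod (t n) <= 2 * (Re (t 0%nat) - m).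
Proof.
intros Hn Hre.
(* [S K = M + n + 1] nodes: conjugating [T] against [u^-n] produces the
   frequencies [-(j + n)] with [j <= M], which must not alias to 0. *)
set (K := (M + n)%nat); set (w := unity_root (S K)).
assert (Hw1 : forall k, Cmod (w ^ k)%C = 1).
{ intros k; unfold w, unity_root; rewrite Cmod_pow, Cmod_cis; apply pow1. }
assert (HwN : (w ^ S K)%C = RtoC 1) by (apply unity_root_pow; lia).
assert (Hprim : forall j, (0 < j < S K)%nat -> (w ^ j)%C <> RtoC 1)
  by (intros j; apply unity_root_primitive).
set (T := fun k => Cpoly t M (w ^ k)%C).
assert (E0 : Csum T K = (RtoC (INR (S K)) * t 0%nat)%C).
{ rewrite <- (unity_root_average t M K 0 0); [|lia|reflexivity|].
  - apply Csum_ext; intros k _; unfold T; fold w; simpl; ring.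
  - intros j Hj Hne; apply Hprim; lia. }
assert (E1 : Csum (fun k => T k * (w ^ k) ^ (S K - n))%C K = (RtoC (INR (S K)) * t n)%C).
{ unfold T, w; apply unity_root_average; [lia| |].
  - replace (n + (S K - n))%nat with (S K) by (unfold K; lia). exact HwN.
  - intros j Hj Hne; fold w.
    destruct (Nat.lt_ge_cases j n).
    + apply Hprim; unfold K; lia.
    + replace (j + (S K - n))%nat with (S K + (j - n))%nat by (unfold K; lia).
      rewrite Cpow_add_r, HwN, Cmult_1_l; apply Hprim; unfold K; lia. }
(* [u^(S K - n)] plays the part of [u^-n] at the nodes, so this says that
   [conj T] has no frequency [n]. *)
assert (E2 : Csum (fun k => T k * (w ^ k) ^ n)%C K = RtoC 0).
{ apply unity_root_average_0; intros j Hj; apply Hprim; unfold K; lia. }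
assert (E3 : Csum (fun k => (w ^ k) ^ (S K - n))%C K = RtoC 0).
{ rewrite <- (Csum_unity_root_powers K (S K - n)) by (apply Hprim; unfold K; lia).
  apply Csum_ext; intros k _; fold w. rewrite <- !Cpow_mult_r; f_equal; ring. }
assert (Hconj : forall k, Cconj ((w ^ k) ^ n)%C = ((w ^ k) ^ (S K - n))%C).
{ intros k; set (u := (w ^ k)%C).
  assert (Hu : (u ^ n * Cconj (u ^ n))%C = RtoC 1).
  { rewrite <- Cmod2_conj, Cmod_pow; unfold u; rewrite Hw1, pow1, pow1; reflexivity. }
  assert (Hu2 : (u ^ n * u ^ (S K - n))%C = RtoC 1).
  { rewrite <- Cpow_add_r. replace (n + (S K - n))%nat with (S K) by (unfold K; lia).
    unfold u; rewrite <- Cpow_mult_r, Nat.mul_comm, Cpow_mult_r, HwN; apply Cpow_1_l. }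
  transitivity ((u ^ n * u ^ (S K - n)) * Cconj (u ^ n))%C.
  - rewrite Hu2; ring.
  - transitivity ((u ^ n * Cconj (u ^ n)) * u ^ (S K - n))%C; [ring|].
    rewrite Hu; ring. }
assert (E4 : Csum (fun k => RtoC (2 * (Re (T k) - m)) * (w ^ k) ^ (S K - n))%C K
             = (RtoC (INR (S K)) * t n)%C).
{ rewrite (Csum_ext _ (fun k => T k * (w ^ k) ^ (S K - n) +
     (Cconj (T k * (w ^ k) ^ n) + RtoC (- (2 * m)) * (w ^ k) ^ (S K - n)))%C).
  - rewrite !Csum_plus, E1, <- Csum_conj, E2, Csum_mult_l, E3.
    replace (Cconj 0) with (RtoC 0); [ring|].
    unfold Cconj, RtoC; simpl; f_equal; ring.
  - intros k _; rewrite Cmult_conj, Hconj.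
    replace (RtoC (2 * (Re (T k) - m))) with (T k + Cconj (T k) + RtoC (- (2 * m)))%C; [ring|].
    destruct (T k) as [x y]; unfold Cconj, Cplus, RtoC; simpl; f_equal; ring. }
assert (HN : 0 < INR (S K)) by (apply lt_0_INR; lia).
apply Rmult_le_reg_l with (INR (S K)); [exact HN|].
replace (INR (S K) * Cmod (t n)) with (Cmod (RtoC (INR (S K)) * t n)%C)
  by (rewrite Cmod_mult, Cmod_R, Rabs_pos_eq; lra).
rewrite <- E4.
eapply Rle_trans.
- apply (Cmod_Csum_le _ (fun k => Re (RtoC 2 * T k + RtoC (- (2 * m)))%C)).
  intros k _; rewrite Cmod_mult, Cmod_pow, Hw1, pow1, Cmod_R.
  assert (Hk : m <= Re (T k)) by (apply Hre, Hw1).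
  rewrite Rabs_pos_eq by lra.
  destruct (T k) as [x y]; simpl in *; lra.
- rewrite <- Re_Csum, Csum_plus, Csum_mult_l, Csum_const, E0.
  destruct (t 0%nat) as [x y]; simpl; lra.
Qed.

(** * Power series on the disc *)

Lemma is_pseries_C_iff a z l :
  is_pseries (K := C_AbsRing) (V := C_NormedModule) a z l <->
  forall eps, 0 < eps -> exists N0, forall N, (N0 <= N)%nat ->
    Cmod (Cpoly a N z - l)%C < eps.
Proof.
assert (E : forall N, sum_n (fun k => scal (pow_n z k) (a k)) N = Cpoly a N z :> C).
{ intros N; apply sum_n_ext; intros k; apply Cmult_comm. }
split.
- intros H eps Heps.
  destruct (proj1 (filterlim_locally_ball_norm (K := C_AbsRing) (U := C_NormedModule) _ _) H
              (mkposreal eps Heps)) as [N0 HN0].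
  exists N0; intros N HN; rewrite <- E; exact (HN0 N HN).
- intros H.
  apply (filterlim_locally_ball_norm (K := C_AbsRing) (U := C_NormedModule)).
  intros eps; destruct (H eps (cond_pos eps)) as [N0 HN0].
  exists N0; intros N HN; specialize (HN0 N HN); rewrite <- E in HN0; exact HN0.
Qed.

(** Convergence at some [rho] with [r < rho < 1] forces [|a_k| rho^k <= 1] for
    large [k], so on [|z| <= r] the tails are dominated by those of the
    geometric series of ratio [s = r / rho]. *)
Lemma pseries_uniform_on_disc p a r : disc_expansion p a -> 0 <= r < 1 ->
  forall eps, 0 < eps -> exists M0, forall M z, (M0 <= M)%nat -> Cmod z <= r ->
    Cmod (Cpoly a M z - p z)%C <= eps.
Proof.
intros [_ Hp] Hr eps Heps.
set (rho := (1 + r) / 2).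
assert (Hrho : r < rho < 1) by (unfold rho; lra).
set (s := r / rho).
assert (Hs : 0 <= s < 1).
{ unfold s; split; [apply Rdiv_le_0_compat; lra|].
  apply Rmult_lt_reg_r with rho; [lra|].
  unfold Rdiv; rewrite Rmult_assoc, Rinv_l; lra. }
assert (Hdisc : in_disc (RtoC rho)).
{ unfold in_disc; rewrite Cmod_R, Rabs_pos_eq; lra. }
destruct (proj1 (is_pseries_C_iff _ _ _) (Hp _ Hdisc) (1 / 2)) as [M1 HM1]; [lra|].
assert (Hterm : forall k, (M1 <= k)%nat -> Cmod (a (S k)) * rho ^ S k <= 1).
{ intros k Hk.
  replace (Cmod (a (S k)) * rho ^ S k) with (Cmod (a (S k) * rho ^ S k)%C).
  2:{ rewrite Cmod_mult, Cmod_pow, Cmod_R, Rabs_pos_eq; lra. }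
  replace (a (S k) * rho ^ S k)%C with
    ((Cpoly a (S k) rho - p rho) + - (Cpoly a k rho - p rho))%C
    by (unfold Cpoly; rewrite Csum_S; ring).
  eapply Rle_trans; [apply Cmod_triangle|]. rewrite Cmod_opp.
  generalize (HM1 k Hk) (HM1 (S k) (Nat.le_trans _ _ _ Hk (Nat.le_succ_diag_r _))); lra. }
destruct (pow_lt_1_zero s) with (y := eps / 2 * (1 - s)) as [M2 HM2].
{ rewrite Rabs_pos_eq; lra. }
{ apply Rmult_lt_0_compat; lra. }
exists (M1 + M2)%nat; intros M z HM Hz.
(* Geometric tail bound, multiplied out by [1 - s] so that it telescopes. *)
assert (Htail : forall j,
  Cmod (Cpoly a (M + j) z - Cpoly a M z)%C * (1 - s) <= s ^ S M - s ^ S (M + j)).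
{ induction j as [|j IH].
  - rewrite Nat.add_0_r; replace (Cpoly a M z - Cpoly a M z)%C with (RtoC 0) by ring.
    rewrite Cmod_0; lra.
  - rewrite Nat.add_succ_r.
    replace (Cpoly a (S (M + j)) z - Cpoly a M z)%C with
      ((Cpoly a (M + j) z - Cpoly a M z) + a (S (M + j)) * z ^ S (M + j))%C
      by (unfold Cpoly; rewrite Csum_S; ring).
    assert (Ht : Cmod (a (S (M + j)) * z ^ S (M + j))%C <= s ^ S (M + j)).
    { rewrite Cmod_mult, Cmod_pow.
      eapply Rle_trans.
      - apply Rmult_le_compat_l; [apply Cmod_ge_0|].
        apply pow_incr; split; [apply Cmod_ge_0|exact Hz].
      - replace (r ^ S (M + j)) with (rho ^ S (M + j) * s ^ S (M + j))
          by (rewrite <- Rpow_mult_distr; f_equal; unfold s; field; lra).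
        generalize (Rmult_le_compat_r (s ^ S (M + j)) _ _
          (pow_le s (S (M + j)) (proj1 Hs)) (Hterm (M + j)%nat ltac:(lia))); lra. }
    eapply Rle_trans.
    + apply Rmult_le_compat_r; [lra|apply Cmod_triangle].
    + change (s ^ S (S (M + j))) with (s * s ^ S (M + j)). nra. }
destruct (proj1 (is_pseries_C_iff _ _ _) (Hp z ltac:(unfold in_disc; lra)) (eps / 2))
  as [L HL]; [lra|].
replace (Cpoly a M z - p z)%C with
  ((Cpoly a (M + L) z - p z) + - (Cpoly a (M + L) z - Cpoly a M z))%C by ring.
eapply Rle_trans; [apply Cmod_triangle|]; rewrite Cmod_opp.
assert (H1 := HL (M + L)%nat ltac:(lia)).
assert (H2 := Htail L).
assert (H3 : Rabs (s ^ S M) < eps / 2 * (1 - s)) by (apply HM2; lia).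
rewrite Rabs_pos_eq in H3 by (apply pow_le; lra).
assert (H4 : 0 <= s ^ S (M + L)) by (apply pow_le; lra).
assert (H5 : Cmod (Cpoly a (M + L) z - Cpoly a M z)%C <= eps / 2).
{ apply Rmult_le_reg_r with (1 - s); lra. }
lra.
Qed.

(** Serves both passages to the limit: [r -> 1] for the coefficients, and
    [1 - rho -> 1 - |z|] for the derivative. *)
Lemma pow_bound_left_limit n A B s : 0 < s ->
  (forall r, 0 < r < s -> r ^ n * A <= B) -> s ^ n * A <= B.
Proof.
intros Hs H.
destruct (Rle_or_lt (s ^ n * A) B) as [|Hlt]; [assumption|exfalso].
assert (Hc : continuity_pt (fun r => r ^ n * A) s).
{ apply (continuity_pt_mult (fun r => r ^ n) (fun _ => A)).
  - apply derivable_continuous_pt; exists (INR n * s ^ pred n); apply derivable_pt_lim_pow.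
  - apply continuity_pt_const; intros x y; reflexivity. }
destruct (Hc (s ^ n * A - B)) as [d [Hd HC]]; [lra|].
set (r := s - Rmin (d / 2) (s / 2)).
assert (Hm : 0 < Rmin (d / 2) (s / 2)) by (apply Rmin_glb_lt; lra).
assert (Hm1 := Rmin_l (d / 2) (s / 2)).
assert (Hm2 := Rmin_r (d / 2) (s / 2)).
specialize (HC r); simpl in HC; unfold Rdist, D_x, no_cond in HC.
assert (Hr : r ^ n * A <= B) by (apply H; unfold r; lra).
assert (Hcl : Rabs (r ^ n * A - s ^ n * A) < s ^ n * A - B).
{ apply HC; repeat split; [unfold r; lra|].
  unfold r; rewrite Rabs_left; lra. }
apply Rabs_def2 in Hcl; lra.
Qed.

Lemma Re_cis_mult_ge lam z : - Cmod z <= Re (cis lam * z)%C.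
Proof.
generalize (re_le_Cmod (cis lam * z)%C); rewrite Cmod_mult, Cmod_cis.
intros H; apply Rabs_le_between in H; lra.
Qed.

(** * The coefficient bound in the class *)

Lemma class_P_coef_bound lam p a n : class_P lam p -> disc_expansion p a ->
  (1 <= n)%nat -> Cmod (a n) <= 2 * cos lam.
Proof.
intros [_ Hre] Hexp Hn.
rewrite <- (Rmult_1_l (Cmod (a n))), <- (pow1 n).
apply pow_bound_left_limit; [lra|intros r Hr].
apply le_epsilon; intros eps Heps.
destruct (pseries_uniform_on_disc p a r Hexp ltac:(lra) (eps / 2)) as [M0 HM]; [lra|].
(* The coefficients of [e^{i lam} p (r z)]. *)
set (t := fun k => (cis lam * (a k * r ^ k))%C).
assert (Hb : Cmod (t n) <= 2 * (Re (t 0%nat) - - (eps / 2))).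
{ apply (Cpoly_coef_bound t (M0 + n)); [lia|].
  intros u Hu.
  assert (Hru : Cmod (r * u)%C = r) by (rewrite Cmod_mult, Hu, Cmod_R, Rabs_pos_eq; lra).
  replace (Cpoly t (M0 + n) u) with
    (cis lam * p (r * u) + cis lam * (Cpoly a (M0 + n) (r * u) - p (r * u)))%C.
  - generalize (Hre (r * u)%C ltac:(unfold in_disc; lra))
      (Re_cis_mult_ge lam (Cpoly a (M0 + n) (r * u) - p (r * u))%C)
      (HM (M0 + n)%nat (r * u)%C ltac:(lia) ltac:(lra)).
    change (Re (?x + ?y)%C) with (Re x + Re y); lra.
  - transitivity (cis lam * Cpoly a (M0 + n) (r * u))%C; [ring|].
    unfold Cpoly; rewrite <- Csum_mult_l; apply Csum_ext; intros k _.
    unfold t; rewrite Cpow_mult_l; ring. }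
unfold t in Hb; rewrite !Cmod_mult, Cmod_cis, Cmod_pow, Cmod_R, Rabs_pos_eq in Hb by lra.
rewrite (proj1 Hexp) in Hb. simpl in Hb. lra.
Qed.

(** * The derivative bound *)

Lemma Cpow_minus_bound z w rho n : Cmod z <= rho -> Cmod w <= rho ->
  Cmod (w ^ n - z ^ n)%C <= INR n * rho ^ pred n * Cmod (w - z)%C.
Proof.
intros Hz Hw. assert (H0 := Cmod_ge_0 z).
induction n as [|n IH].
- simpl; replace (1 - 1)%C with (RtoC 0) by ring; rewrite Cmod_0; lra.
- replace (w ^ S n - z ^ S n)%C with (w * (w ^ n - z ^ n) + (w - z) * z ^ n)%C
    by (rewrite !Cpow_S; ring).
  eapply Rle_trans; [apply Cmod_triangle|]; rewrite !Cmod_mult, Cmod_pow.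
  assert (Hzn : Cmod z ^ n <= rho ^ n) by (apply pow_incr; lra).
  assert (H1 : Cmod w * Cmod (w ^ n - z ^ n)%C <=
               rho * (INR n * rho ^ pred n * Cmod (w - z)%C)).
  { apply Rmult_le_compat; auto using Cmod_ge_0. }
  assert (H2 : Cmod (w - z)%C * Cmod z ^ n <= Cmod (w - z)%C * rho ^ n).
  { apply Rmult_le_compat_l; auto using Cmod_ge_0. }
  assert (H3 : rho * (INR n * rho ^ pred n) = INR n * rho ^ n).
  { destruct n; simpl; ring. }
  rewrite <- Rmult_assoc, H3 in H1.
  rewrite S_INR; simpl pred; lra.
Qed.

Lemma sum_pow_deriv_bound rho N : 0 <= rho < 1 ->
  (1 - rho) ^ 2 * sum_f_R0 (fun k => INR k * rho ^ pred k) N <= 1.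
Proof.
intros Hr.
(* The closed form of the derivative of the finite geometric sum. *)
assert (E : (1 - rho) ^ 2 * sum_f_R0 (fun k => INR k * rho ^ pred k) N
            = 1 - (INR N * (1 - rho) + 1) * rho ^ N).
{ induction N as [|N IH]; [simpl; ring|].
  rewrite tech5, Rmult_plus_distr_l, IH, S_INR; simpl pred; simpl pow; ring. }
rewrite E.
assert (0 <= (INR N * (1 - rho) + 1) * rho ^ N); [|lra].
apply Rmult_le_pos; [|apply pow_le; lra].
generalize (pos_INR N); nra.
Qed.

(** Every pair of partial sums obeys the bound, because
    [sum_k k rho^(k-1) <= 1 / (1 - rho)^2]; the limit inherits it. *)
Lemma bounded_coef_lipschitz p a B rho z w : disc_expansion p a ->
  (forall n, (1 <= n)%nat -> Cmod (a n) <= B) -> rho < 1 ->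
  Cmod z <= rho -> Cmod w <= rho ->
  (1 - rho) ^ 2 * Cmod (p w - p z)%C <= B * Cmod (w - z)%C.
Proof.
intros [_ Hp] Ha Hrho Hz Hw. assert (H0 := Cmod_ge_0 z).
assert (HB : 0 <= B) by (generalize (Ha 1%nat (Nat.le_refl _)) (Cmod_ge_0 (a 1%nat)); lra).
assert (Hpart : forall N, (1 - rho) ^ 2 * Cmod (Cpoly a N w - Cpoly a N z)%C <= B * Cmod (w - z)%C).
{ intros N.
  replace (Cpoly a N w - Cpoly a N z)%C with (Csum (fun k => a k * (w ^ k - z ^ k))%C N).
  2:{ rewrite (Csum_ext _ (fun k => a k * w ^ k + - (1) * (a k * z ^ k))%C) by (intros; ring).
      rewrite Csum_plus, Csum_mult_l; unfold Cpoly; ring. }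
  assert (HN : Cmod (Csum (fun k => a k * (w ^ k - z ^ k))%C N) <=
     B * Cmod (w - z)%C * sum_f_R0 (fun k => INR k * rho ^ pred k) N).
  { rewrite scal_sum; apply Cmod_Csum_le; intros k _; rewrite Cmod_mult.
    generalize (Cpow_minus_bound z w rho k Hz Hw); intros Hk.
    destruct k as [|k].
    - simpl; replace (1 - 1)%C with (RtoC 0) by ring; rewrite Cmod_0; lra.
    - generalize (Rmult_le_compat _ _ _ _ (Cmod_ge_0 (a (S k))) (Cmod_ge_0 _)
        (Ha (S k) ltac:(lia)) Hk); lra. }
  generalize (sum_pow_deriv_bound rho N ltac:(lra)); intros Hs.
  assert (Hc : 0 <= B * Cmod (w - z)%C) by (apply Rmult_le_pos; auto using Cmod_ge_0).
  assert (H2 : 0 <= (1 - rho) ^ 2) by apply pow2_ge_0.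
  nra. }
apply le_epsilon; intros eps Heps.
destruct (proj1 (is_pseries_C_iff _ _ _) (Hp z ltac:(unfold in_disc; lra)) (eps / 2))
  as [N1 H1]; [lra|].
destruct (proj1 (is_pseries_C_iff _ _ _) (Hp w ltac:(unfold in_disc; lra)) (eps / 2))
  as [N2 H2]; [lra|].
set (N := (N1 + N2)%nat).
specialize (H1 N ltac:(unfold N; lia)); specialize (H2 N ltac:(unfold N; lia)).
specialize (Hpart N).
assert (H3 : Cmod (p w - p z)%C <= Cmod (Cpoly a N w - Cpoly a N z)%C + eps).
{ replace (p w - p z)%C with ((Cpoly a N w - Cpoly a N z) +
    ((Cpoly a N z - p z) + - (Cpoly a N w - p w)))%C by ring.
  eapply Rle_trans; [apply Cmod_triangle|].
  generalize (Cmod_triangle (Cpoly a N z - p z) (- (Cpoly a N w - p w))); rewrite Cmod_opp; lra. }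
assert (H4 : 0 <= (1 - rho) ^ 2 <= 1) by nra.
nra.
Qed.

Lemma is_derive_C_iff (f : C -> C) (z l : C) :
  is_derive (K := C_AbsRing) (V := C_NormedModule) f z l <->
  forall eps, 0 < eps -> exists d, 0 < d /\ forall w, Cmod (w - z)%C < d ->
    Cmod (f w - f z - (w - z) * l)%C <= eps * Cmod (w - z)%C.
Proof.
split.
- intros [_ H] eps Heps.
  destruct (H z (fun P HP => HP) (mkposreal eps Heps)) as [d Hd].
  exists d; split; [apply cond_pos|]; intros w Hw.
  exact (Hd w Hw).
- intros H; split; [apply is_linear_scal_l|].
  intros y Hy; rewrite <- (is_filter_lim_locally_unique _ _ Hy).
  intros eps; destruct (H eps (cond_pos eps)) as [d [Hd Hw]].
  exists (mkposreal d Hd); intros w Hwd.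
  exact (Hw w Hwd).
Qed.

(** The derivative at [z] is a limit of difference quotients along the real
    direction [z + h]; keeping [|z + h| <= rho] for some [rho > |z|] makes the
    Lipschitz bound available, and [rho] is then brought down to [|z|]. *)
Lemma bounded_coef_derivative p a B z l : disc_expansion p a ->
  (forall n, (1 <= n)%nat -> Cmod (a n) <= B) -> in_disc z ->
  is_derive (K := C_AbsRing) (V := C_NormedModule) p z l ->
  Cmod l <= B / (1 - Cmod z) ^ 2.
Proof.
unfold in_disc; intros Hexp Ha Hz Hl.
assert (Hz0 := Cmod_ge_0 z).
assert (Hp : 0 < (1 - Cmod z) ^ 2) by (apply pow_lt; lra).
apply Rmult_le_reg_l with ((1 - Cmod z) ^ 2); [exact Hp|].
replace ((1 - Cmod z) ^ 2 * (B / (1 - Cmod z) ^ 2)) with B by (field; lra).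
(* Here [s] stands for [1 - rho]. *)
apply pow_bound_left_limit; [lra|intros s Hs].
apply le_epsilon; intros eps Heps.
destruct (proj1 (is_derive_C_iff p z l) Hl eps Heps) as [d [Hd Hw]].
set (h := Rmin (d / 2) (1 - s - Cmod z)).
assert (Hh : 0 < h) by (apply Rmin_glb_lt; lra).
assert (Hh1 : h <= d / 2) by apply Rmin_l.
assert (Hh2 : h <= 1 - s - Cmod z) by apply Rmin_r.
assert (Hhm : Cmod h = h) by (rewrite Cmod_R, Rabs_pos_eq; lra).
assert (Hd1 : (z + h - z)%C = h) by ring.
specialize (Hw (z + h)%C); rewrite Hd1, Hhm in Hw; specialize (Hw ltac:(lra)).
assert (Hlip : (1 - (1 - s)) ^ 2 * Cmod (p (z + h) - p z)%C <= B * Cmod (z + h - z)%C).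
{ apply (bounded_coef_lipschitz p a); auto; [lra|lra|].
  eapply Rle_trans; [apply Cmod_triangle|lra]. }
rewrite Hd1, Hhm in Hlip.
assert (Htri : h * Cmod l <= Cmod (p (z + h) - p z)%C + eps * h).
{ replace (h * Cmod l) with (Cmod (h * l)%C) by (rewrite Cmod_mult, Hhm; reflexivity).
  replace (h * l)%C with ((p (z + h) - p z) + - (p (z + h) - p z - h * l))%C by ring.
  eapply Rle_trans; [apply Cmod_triangle|]; rewrite Cmod_opp; lra. }
replace (1 - (1 - s)) with s in Hlip by ring.
assert (Hs2 : 0 < s ^ 2 <= 1) by (simpl; nra).
apply Rmult_le_reg_l with h; [exact Hh|].
assert (H1 := Rmult_le_compat_l (s ^ 2) _ _ (Rlt_le _ _ (proj1 Hs2)) Htri).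
assert (H2 : s ^ 2 * (eps * h) <= 1 * (eps * h)) by (apply Rmult_le_compat_r; nra).
lra.
Qed.

(** * The extremal functions *)

Lemma one_plus_cis lam : (1 + cis (- 2 * lam))%C = (RtoC (2 * cos lam) * cis (- lam))%C.
Proof.
unfold cis, RtoC, Cplus, Cmult; simpl.
replace (- 2 * lam) with (- (2 * lam)) by ring.
rewrite !cos_neg, !sin_neg, cos_2a, sin_2a.
generalize (sin2_cos2 lam); unfold Rsqr; intros H.
apply injective_projections; simpl; lra.
Qed.

Lemma Cmod_one_plus_cis lam : 0 < cos lam -> Cmod (1 + cis (- 2 * lam))%C = 2 * cos lam.
Proof.
intros H; rewrite one_plus_cis, Cmod_mult, Cmod_cis, Cmod_R, Rabs_pos_eq; lra.
Qed.

Lemma Cmod_one_minus_ge u : 1 - Cmod u <= Cmod (1 - u)%C.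
Proof.
generalize (Cmod_triangle (1 - u) u); replace (1 - u + u)%C with (RtoC 1) by ring.
rewrite Cmod_1; lra.
Qed.

Lemma one_minus_neq_0 u : in_disc u -> (1 - u)%C <> RtoC 0.
Proof.
unfold in_disc; intros Hu; apply Cmod_gt_0; generalize (Cmod_one_minus_ge u); lra.
Qed.

(** Rotated by [e^{i lam}], [p_lam] becomes an affine image of the Cayley map,
    and the affine map preserves the right half-plane when [cos lam > 0]. *)
Lemma cis_mult_p_lam lam u : in_disc u ->
  (cis lam * p_lam lam u)%C = (Ci * sin lam + cos lam * ((1 + u) / (1 - u)))%C.
Proof.
intros Hu; unfold p_lam.
assert (H1 : (cis lam * cis (- 2 * lam))%C = cis (- lam)).
{ rewrite <- cis_plus; f_equal; ring. }
assert (H2 : cis lam = (cos lam + Ci * sin lam)%C).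
{ unfold cis, Ci, RtoC, Cplus, Cmult; simpl; f_equal; ring. }
assert (H3 : cis (- lam) = (cos lam - Ci * sin lam)%C).
{ unfold cis, Ci, RtoC, Cminus, Cplus, Copp, Cmult; simpl.
  rewrite cos_neg, sin_neg; f_equal; ring. }
transitivity ((cis lam + (cis lam * cis (- 2 * lam)) * u) / (1 - u))%C.
- field; now apply one_minus_neq_0.
- rewrite H1, H2, H3; field; now apply one_minus_neq_0.
Qed.

Lemma Re_cayley_pos u : in_disc u -> 0 < Re ((1 + u) / (1 - u))%C.
Proof.
intros Hu.
assert (Hne := one_minus_neq_0 u Hu).
assert (H2 : Cmod u ^ 2 < 1).
{ unfold in_disc in Hu; generalize (Cmod_ge_0 u); simpl; nra. }
assert (H3 : 0 < Cmod (1 - u)%C ^ 2) by (apply pow_lt, Cmod_gt_0, Hne).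
rewrite Cmod2_alt in H2, H3.
destruct u as [x y]; simpl in *.
match goal with |- 0 < ?e => replace e with
  ((1 - (x * x + y * y)) / ((1 + - x) * (1 + - x) + (0 + - y) * (0 + - y)))
  by (field; nra) end.
apply Rdiv_lt_0_compat; nra.
Qed.

Lemma in_disc_rotate x z : Cmod x = 1 -> in_disc z -> in_disc (x * z)%C.
Proof. intros hx; unfold in_disc; rewrite Cmod_mult, hx; lra. Qed.

Lemma is_derive_p_lam_rotate lam x z : 0 < cos lam -> Cmod x = 1 -> in_disc z ->
  is_derive (K := C_AbsRing) (V := C_NormedModule) (fun w : C => p_lam lam (x * w)%C) z
    ((1 + cis (- 2 * lam)) * x / (1 - x * z) ^ 2)%C.
Proof.
intros hlam hx Hz; apply is_derive_C_iff; intros eps Heps.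
set (s := 1 - Cmod z).
assert (Hs : 0 < s) by (unfold s, in_disc in *; lra).
assert (Hs3 : 0 < s ^ 3) by now apply pow_lt.
(* [|w - z| < s / 2] keeps [|1 - x w| >= s / 2], so that the remainder computed
   below is at most [2 * (2 / s^3) |w - z|^2]; this yields the second bound. *)
exists (Rmin (s / 2) (eps * s ^ 3 / 4)); split.
{ apply Rmin_glb_lt; [lra|]. nra. }
intros w Hw.
assert (Hw1 := Rlt_le_trans _ _ _ Hw (Rmin_l _ _)).
assert (Hw2 := Rlt_le_trans _ _ _ Hw (Rmin_r _ _)).
assert (Hwm : Cmod w <= 1 - s / 2).
{ generalize (Cmod_triangle (w - z) z); replace (w - z + z)%C with w by ring; unfold s in *; lra. }
assert (HA := one_minus_neq_0 _ (in_disc_rotate x z hx Hz)).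
assert (HB := one_minus_neq_0 _ (in_disc_rotate x w hx ltac:(unfold in_disc; lra))).
assert (HAm : s <= Cmod (1 - x * z)%C).
{ generalize (Cmod_one_minus_ge (x * z)%C); rewrite Cmod_mult, hx; unfold s; lra. }
assert (HBm : s / 2 <= Cmod (1 - x * w)%C).
{ generalize (Cmod_one_minus_ge (x * w)%C); rewrite Cmod_mult, hx; lra. }
replace (p_lam lam (x * w) - p_lam lam (x * z) -
   (w - z) * ((1 + cis (- 2 * lam)) * x / (1 - x * z) ^ 2))%C with
  ((1 + cis (- 2 * lam)) * (x * x) * ((w - z) * (w - z)) /
     ((1 - x * w) * (1 - x * z) ^ 2))%C
  by (unfold p_lam; field; auto).
rewrite Cmod_div by (apply Cmult_neq_0; [exact HB|now apply Cpow_nz]).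
rewrite !Cmod_mult, Cmod_pow, hx, Cmod_one_plus_cis by exact hlam.
set (h := Cmod (w - z)%C) in *.
assert (Hh : 0 <= h) by apply Cmod_ge_0.
assert (HD : s ^ 3 / 2 <= Cmod (1 - x * w)%C * Cmod (1 - x * z)%C ^ 2).
{ replace (s ^ 3 / 2) with (s / 2 * s ^ 2) by field.
  apply Rmult_le_compat; [lra|apply pow2_ge_0|exact HBm|apply pow_incr; lra]. }
set (D := Cmod (1 - x * w)%C * Cmod (1 - x * z)%C ^ 2) in *.
apply Rmult_le_reg_r with D; [lra|].
replace (2 * cos lam * (1 * 1) * (h * h) / D * D) with (2 * cos lam * (h * h)) by (field; lra).
assert (Hc := proj2 (COS_bound lam)).
apply Rle_trans with (eps * h * (s ^ 3 / 2)).
- apply Rle_trans with (2 * 1 * (h * h)).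
  + apply Rmult_le_compat_r; nra.
  + assert (h * h <= h * (eps * s ^ 3 / 4)) by (apply Rmult_le_compat_l; lra). lra.
- apply Rmult_le_compat_l; [nra|exact HD].
Qed.

Lemma class_P_p_lam_rotate lam x : 0 < cos lam -> Cmod x = 1 ->
  class_P lam (fun z : C => p_lam lam (x * z)%C).
Proof.
intros hlam hx; split; [split|].
- intros z Hz; eexists; now apply is_derive_p_lam_rotate.
- unfold p_lam; field.
- intros z Hz; assert (Hu := in_disc_rotate x z hx Hz).
  rewrite cis_mult_p_lam by exact Hu.
  assert (HR := Re_cayley_pos _ Hu).
  destruct ((1 + x * z) / (1 - x * z))%C as [a b]; simpl in *; nra.
Qed.

Definition p_lam_coef (lam : R) (x : C) (n : nat) : C :=
  match n with 0%nat => RtoC 1 | _ => ((1 + cis (- 2 * lam)) * x ^ n)%C end.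

Lemma Cmod_p_lam_coef lam x n : 0 < cos lam -> Cmod x = 1 -> (1 <= n)%nat ->
  Cmod (p_lam_coef lam x n) = 2 * cos lam.
Proof.
intros hlam hx Hn; destruct n as [|n]; [lia|].
unfold p_lam_coef.
rewrite Cmod_mult, Cmod_pow, hx, pow1, Cmod_one_plus_cis by exact hlam; ring.
Qed.

Lemma disc_expansion_p_lam_rotate lam x : 0 < cos lam -> Cmod x = 1 ->
  disc_expansion (fun z : C => p_lam lam (x * z)%C) (p_lam_coef lam x).
Proof.
intros hlam hx; split; [reflexivity|]; intros z Hz.
assert (Hu := in_disc_rotate x z hx Hz); set (u := (x * z)%C) in *.
assert (Hne := one_minus_neq_0 u Hu).
(* The remainder of the geometric series, in closed form. *)
assert (E : forall N, (Cpoly (p_lam_coef lam x) N z - p_lam lam u =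
   - ((1 + cis (- 2 * lam)) * u ^ S N / (1 - u)))%C).
{ intros N; unfold p_lam; induction N as [|N IH].
  - unfold Cpoly; rewrite Csum_O; simpl; field; exact Hne.
  - unfold Cpoly in *; rewrite Csum_S.
    transitivity (Csum (fun k => p_lam_coef lam x k * z ^ k)%C N
       - (1 + cis (-2 * lam) * u) / (1 - u) + p_lam_coef lam x (S N) * z ^ S N)%C; [ring|].
    rewrite IH; unfold p_lam_coef.
    rewrite <- Cmult_assoc, <- Cpow_mult_l; fold u; rewrite !(Cpow_S u).
    field; exact Hne. }
apply is_pseries_C_iff; intros eps Heps.
assert (H1 : 0 < Cmod (1 - u)%C) by now apply Cmod_gt_0.
destruct (pow_lt_1_zero (Cmod u)) with (y := eps * Cmod (1 - u)%C / (2 * cos lam)) as [N0 HN0].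
{ rewrite Rabs_pos_eq; [exact Hu|apply Cmod_ge_0]. }
{ apply Rdiv_lt_0_compat; [now apply Rmult_lt_0_compat|lra]. }
exists N0; intros N HN; specialize (HN0 (S N) ltac:(lia)).
rewrite Rabs_pos_eq in HN0 by (apply pow_le, Cmod_ge_0).
rewrite E, Cmod_opp, Cmod_div, Cmod_mult, Cmod_pow, Cmod_one_plus_cis by assumption.
apply Rmult_lt_reg_r with (Cmod (1 - u)%C); [exact H1|].
apply Rmult_lt_reg_r with (/ (2 * cos lam)); [apply Rinv_0_lt_compat; lra|].
replace (2 * cos lam * Cmod u ^ S N / Cmod (1 - u) * Cmod (1 - u) * / (2 * cos lam))
  with (Cmod u ^ S N) by (field; lra).
exact HN0.
Qed.

Lemma rotate_to_modulus z : exists x, Cmod x = 1 /\ (x * z)%C = RtoC (Cmod z).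
Proof.
destruct (Ceq_dec z 0) as [->|Hz].
- exists (RtoC 1); rewrite Cmod_1, Cmod_0; split; [reflexivity|ring].
- assert (Hm : 0 < Cmod z) by now apply Cmod_gt_0.
  exists (RtoC (Cmod z) / z)%C; split.
  + rewrite Cmod_div, Cmod_R, Rabs_pos_eq by (assumption || lra); field; lra.
  + field; exact Hz.
Qed.

Theorem theorem4 (lam : R) (hlam : - PI / 2 < lam < PI / 2) :
  (forall (p : C -> C) (a : nat -> C),
     class_P lam p -> disc_expansion p a ->
     (forall n : nat, (1 <= n)%nat -> Cmod (a n) <= 2 * cos lam) /\
     (forall z : C, in_disc z ->
        Cmod (C_derive p z) <= 2 * cos lam / (1 - Cmod z) ^ 2)) /\
  (forall n : nat, (1 <= n)%nat ->
     exists (x : C) (b : nat -> C),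
       Cmod x = 1 /\
       class_P lam (fun z : C => p_lam lam (Cmult x z)) /\
       disc_expansion (fun z : C => p_lam lam (Cmult x z)) b /\
       Cmod (b n) = 2 * cos lam) /\
  (forall z : C, in_disc z ->
     exists (x : C) (b : nat -> C),
       Cmod x = 1 /\
       class_P lam (fun w : C => p_lam lam (Cmult x w)) /\
       disc_expansion (fun w : C => p_lam lam (Cmult x w)) b /\
       Cmod (C_derive (fun w : C => p_lam lam (Cmult x w)) z)
         = 2 * cos lam / (1 - Cmod z) ^ 2).
Proof.
assert (Hcos : 0 < cos lam) by (apply cos_gt_0; lra).
split; [|split].
- intros p a HP Hexp.
  assert (Hcoef : forall n, (1 <= n)%nat -> Cmod (a n) <= 2 * cos lam).
  { intros n; now apply (class_P_coef_bound lam p a). }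
  split; [exact Hcoef|]; intros z Hz.
  apply (bounded_coef_derivative p a); auto.
  apply C_derive_correct; [exact z|].
  now apply (proj1 (proj1 HP)).
- intros n Hn; exists (RtoC 1), (p_lam_coef lam 1).
  assert (H1 := Cmod_1).
  split; [exact H1|]. split; [now apply class_P_p_lam_rotate|].
  split; [now apply disc_expansion_p_lam_rotate|now apply Cmod_p_lam_coef].
- intros z Hz; destruct (rotate_to_modulus z) as [x [Hx Hxz]].
  exists x, (p_lam_coef lam x).
  split; [exact Hx|]. split; [now apply class_P_p_lam_rotate|].
  split; [now apply disc_expansion_p_lam_rotate|].
  rewrite (is_C_derive_unique _ _ _ (is_derive_p_lam_rotate lam x z Hcos Hx Hz)), Hxz.
  unfold in_disc in Hz.
  assert (E : (1 - Cmod z)%C = RtoC (1 - Cmod z)) by (rewrite RtoC_minus; reflexivity).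
  assert (Hne : RtoC (1 - Cmod z) <> RtoC 0) by (intros H; apply RtoC_inj in H; lra).
  rewrite E, Cmod_div, Cmod_mult, Cmod_pow, Cmod_R, Rabs_pos_eq, Hx, Cmod_one_plus_cis;
    [now rewrite Rmult_1_r|exact Hcos|lra|now apply Cpow_nz].
Qed.
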